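(* The collection of fuzzy metric spaces $(X,M,* )$ whose $t$-norm satisfies $a*b\neq0$ whenever $a\neq0$ and $b\neq0$ ($a,b\in[0,1]$), as objects, together with the closeness classes $[f]$ of uniformly expansive maps $f$ between such fuzzy metric spaces as morphisms, with composition $[g]\circ[f]=[g\circ f]$, forms a category.
   Context: A continuous $t$-norm is a binary operation $*:[0,1]\times[0,1]\to[0,1]$ that is associative, commutative and continuous, satisfies $a*1=a$ for all $a\in[0,1]$, and satisfies $a*b\leq c*d$ whenever $a\leq c$ and $b\leq d$. A fuzzy metric space (in the sense of George and Veeramani) is a triple $(X,M,* )$ where $X$ is a set, $*$ is a continuous $t$-norm, and $M:X\times X\times(0,\infty)\to[0,1]$ satisfies for all $x,y,z\in X$ and all $s,t>0$: (1) $M(x,y,t)>0$; (2) $M(x,y,t)=1$ if and only if $x=y$; (3) $M(x,y,t)=M(y,x,t)$; (4) $M(x,y,t)*M(y,z,s)\leq M(x,z,t+s)$; (5) $M(x,y,\cdot)$ is continuous on $(0,\infty)$. A map $f:X\to Y$ between fuzzy metric spaces $(X,M_1,*_1)$ and $(Y,M_2,*_2)$ is uniformly expansive if for all $A>0$ and $t>0$ there exist $B>0$ and $t'>0$ such that for all $x,y\in X$, $M_1(x,y,t)\geq A$ implies $M_2(f(x),f(y),t')\geq B$. Two functions $f,g:X\to Y$ from a set $X$ to a fuzzy metric space $(Y,M,* )$ are close, written $f\sim g$, if there exist $r\in(0,1)$ and $t>0$ such that $M(f(x),g(x),t)>1-r$ for all $x\in X$. When the $t$-norm $*$ of $(Y,M,*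 )$ satisfies $a*b\neq0$ for all $a,b\in[0,1]$ with $a\neq0$ and $b\neq0$, closeness is an equivalence relation on functions $X\to Y$; $[f]$ denotes the equivalence class of $f$. *)

(* Defs.v *)
From mathcomp Require Import all_boot all_order all_algebra.
From mathcomp Require Import all_classical all_reals topology.
Set Implicit Arguments.
Unset Strict Implicit.
Unset Printing Implicit Defensive.
Import Order.TTheory GRing.Theory Num.Theory numFieldTopology.Exports.
Local Open Scope classical_set_scope.
Local Open Scope ring_scope.

(* [0, 1] and (0, +oo) as types; as [set_type]s they carry the topology
   induced by that of [R], and [\val] is the inclusion into [R]. *)
Notation unit_itv R := (set_type (`[0, 1]%classic : set R)).
Notation pos_itv R := (set_type (`]0, +oo[%classic : set R)).

Lemma one01_subproof (R : realType) : (1 : R) \in `[0, 1]%classic.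
Proof. by rewrite mem_setE in_itv /= ler01 lexx. Qed.

Definition one01 (R : realType) : unit_itv R := exist _ 1 (one01_subproof R).

Lemma addpos_subproof (R : realType) (t s : pos_itv R) :
  \val t + \val s \in `]0, +oo[%classic.
Proof.
case: t s => [t +] [s +] /=.
by rewrite !mem_setE !in_itv /= !andbT; exact: addr_gt0.
Qed.

Definition addpos (R : realType) (t s : pos_itv R) : pos_itv R :=
  exist _ (\val t + \val s) (addpos_subproof t s).

Record continuous_tnorm (R : realType) := ContinuousTNorm {
  tnorm_op :> unit_itv R -> unit_itv R -> unit_itv R;
  tnormA : associative tnorm_op;
  tnormC : commutative tnorm_op;
  tnorm_continuous :
    continuous (fun ab : unit_itv R * unit_itv R => tnorm_op ab.1 ab.2);
  tnormx1 : forall a, tnorm_op a (one01 R) = a;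
  tnorm_le : forall a b c d : unit_itv R,
    \val a <= \val c -> \val b <= \val d ->
    \val (tnorm_op a b) <= \val (tnorm_op c d) }.

Record fuzzy_metric_space (R : realType) := FuzzyMetricSpace {
  fms_carrier :> Type;
  fms_M : fms_carrier -> fms_carrier -> pos_itv R -> unit_itv R;
  fms_tnorm : continuous_tnorm R;
  fms_gt0 : forall x y t, 0 < \val (fms_M x y t);
  fms_eq1 : forall x y t, \val (fms_M x y t) = 1 <-> x = y;
  fms_sym : forall x y t, fms_M x y t = fms_M y x t;
  fms_triangle : forall x y z t s,
    \val (fms_tnorm (fms_M x y t) (fms_M y z s))
      <= \val (fms_M x z (addpos t s));
  fms_continuous : forall x y, continuous (fms_M x y) }.

Definition tnorm_no_zero_divisor (R : realType) (T : continuous_tnorm R) :=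
  forall a b : unit_itv R,
    \val a != 0 -> \val b != 0 -> \val (T a b) != 0.

Record fms_obj (R : realType) := FmsObj {
  fms_obj_space :> fuzzy_metric_space R;
  fms_obj_tnorm : tnorm_no_zero_divisor (fms_tnorm fms_obj_space) }.

Definition uniformly_expansive (R : realType) (X Y : fuzzy_metric_space R)
    (f : X -> Y) : Prop :=
  forall (A : R) (t : pos_itv R), 0 < A ->
    exists (B : R) (t' : pos_itv R), 0 < B /\
      forall x y : X,
        A <= \val (fms_M x y t) -> B <= \val (fms_M (f x) (f y) t').

Definition close (R : realType) (X : Type) (Y : fuzzy_metric_space R)
    (f g : X -> Y) : Prop :=
  exists (r : R) (t : pos_itv R), 0 < r < 1 /\
    forall x : X, 1 - r < \val (fms_M (f x) (g x) t).

Definition close_class (R : realType) (X : Type) (Y : fuzzy_metric_space R)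
    (f : X -> Y) : set (X -> Y) :=
  [set g | close f g].

Definition close_hom (R : realType) (X Y : fms_obj R) : Type :=
  set_type [set close_class f | f in @uniformly_expansive R X Y].

Definition hom_class (R : realType) (X Y : fms_obj R) (F : close_hom X Y) :
    set (X -> Y) :=
  \val F.

Definition is_category (Obj : Type) (Hom : Obj -> Obj -> Type)
    (comp : forall X Y Z : Obj, Hom Y Z -> Hom X Y -> Hom X Z) : Prop :=
  (forall (W X Y Z : Obj) (h : Hom Y Z) (g : Hom X Y) (f : Hom W X),
     comp W Y Z h (comp W X Y g f) = comp W X Z (comp X Y Z h g) f) /\
  (forall X : Obj, exists e : Hom X X,
     (forall (Y : Obj) (f : Hom X Y), comp X X Y f e = f) /\
     (forall (W : Obj) (g : Hom W X), comp W X X e g = g)).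

(* Main.v *)
(** Everything reduces to uniform positive lower bounds on M: two maps are close
    iff M (f x) (g x) t is bounded below by some B > 0 at some t, and the absence
    of zero divisors turns lower bounds a, b > 0 for M x y t and M y z s into the
    lower bound a * b > 0 for M x z (t + s). *)

Require Import Defs.
From mathcomp Require Import all_boot all_order all_algebra.
From mathcomp Require Import all_classical all_reals topology.
Import numFieldTopology.Exports.
Local Open Scope classical_set_scope.
Local Open Scope ring_scope.
Set Implicit Arguments.
Unset Strict Implicit.
Unset Printing Implicit Defensive.
Import Order.TTheory GRing.Theory Num.Theory.

(* [topology] has its own [close], the one for two points of a space. *)
Local Notation close := Defs.close.

(** This is the form in which bounds come out of [uniformly_expansive] and of the triangle
    inequality. *)
Lemma closeP (R : realType) (X : Type) (Y : fuzzy_metric_space R)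
    (f g : X -> Y) :
  close f g <-> exists (B : R) (t : pos_itv R),
    0 < B /\ forall x, B <= \val (fms_M (f x) (g x) t).
Proof.
split=> [[r [t [/andP[_ r1] fg]]]|[B [t [B0 fg]]]].
  by exists (1 - r), t; split=> [|x]; [rewrite subr_gt0 | exact: ltW].
(* [B] may exceed 1 when [X] is empty, hence the minimum. *)
have m0 : 0 < Order.min B 1 by rewrite lt_min B0 ltr01.
have mh : Order.min B 1 / 2 < Order.min B 1.
  by rewrite ltr_pdivrMr // ltr_pMr // ltr1n.
(* Halving the minimum gives the strict inequality that [close] demands. *)
exists (1 - Order.min B 1 / 2), t; split=> [|x].
  rewrite subr_gt0 ltrBlDr ltrDl divr_gt0 // andbT.
  by apply: (lt_le_trans mh); rewrite ge_min lexx orbT.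
rewrite subKr; apply: (lt_le_trans mh); apply: le_trans (fg x).
by rewrite ge_min lexx.
Qed.

Lemma close_refl (R : realType) (X : Type) (Y : fuzzy_metric_space R)
    (f : X -> Y) : close f f.
Proof.
have t1 : (1 : R) \in `]0, +oo[%classic by rewrite mem_setE in_itv /= ltr01.
apply/closeP; exists 1, (exist _ 1 t1); split=> // x.
by rewrite (proj2 (fms_eq1 _ _ _) erefl).
Qed.

Lemma close_sym (R : realType) (X : Type) (Y : fuzzy_metric_space R)
    (f g : X -> Y) : close f g -> close g f.
Proof.
by move=> [r [t [r01 fg]]]; exists r, t; split=> // x; rewrite fms_sym.
Qed.

(** By monotonicity, the product of the two truncated bounds can serve as [c]; without zero divisors
    it is nonzero, hence positive in [0, 1]. *)
Lemma tnorm_lower_bound (R : realType) (T : continuous_tnorm R) (a b : R) :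
  tnorm_no_zero_divisor T -> 0 < a -> 0 < b ->
  exists2 c : R, 0 < c & forall u v : unit_itv R,
    a <= \val u -> b <= \val v -> c <= \val (T u v).
Proof.
move=> T0 a0 b0.
(* Truncating at 1 turns [a] and [b] into elements of [0, 1]. *)
have trunc01 (x : R) : 0 < x -> Order.min x 1 \in `[0, 1]%classic.
  by move=> x0; rewrite mem_setE in_itv /= le_min ltW //= ler01 ge_min lexx orbT.
pose a' : unit_itv R := exist _ (Order.min a 1) (trunc01 a a0).
pose b' : unit_itv R := exist _ (Order.min b 1) (trunc01 b b0).
exists (\val (T a' b')) => [|u v au bv].
  have T_neq0 : \val (T a' b') != 0.
    by apply: T0; rewrite /= gt_eqF // lt_min ?a0 ?b0 ltr01.
  rewrite lt_neqAle eq_sym T_neq0.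
  by have /set_mem := valP (T a' b'); rewrite /= in_itv /= => /andP[].
by apply: tnorm_le; rewrite /= ge_min ?au ?bv.
Qed.

Lemma close_trans (R : realType) (X : Type) (Y : fms_obj R) (f g h : X -> Y) :
  close f g -> close g h -> close f h.
Proof.
move=> /closeP[a [t [a0 fg]]] /closeP[b [s [b0 gh]]].
have [c c0 cT] := tnorm_lower_bound (@fms_obj_tnorm _ Y) a0 b0.
apply/closeP; exists c, (addpos t s); split=> // x.
exact: le_trans (cT _ _ (fg x) (gh x)) (fms_triangle _ _ _ _ _).
Qed.

Lemma close_classP (R : realType) (X : Type) (Y : fms_obj R) (f g : X -> Y) :
  close_class f = close_class g <-> close f g.
Proof.
split=> [fg|fg]; first by have : close_class g g by [exact: close_refl]; rewrite -fg.
apply/seteqP; split=> h; apply: close_trans => //; exact: close_sym.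
Qed.

Lemma uniformly_expansive_id (R : realType) (X : fuzzy_metric_space R) :
  uniformly_expansive (id : X -> X).
Proof. by move=> A t A0; exists A, t. Qed.

Lemma uniformly_expansive_comp (R : realType) (X Y Z : fuzzy_metric_space R)
    (g : Y -> Z) (f : X -> Y) :
  uniformly_expansive g -> uniformly_expansive f -> uniformly_expansive (g \o f).
Proof.
move=> gU fU A t /fU-/(_ t)[B [s [B0 fB]]]; have [C [u [C0 gC]]] := gU B s B0.
by exists C, u; split=> // x y /fB; exact: gC.
Qed.

(** The intermediate map is [g \o f']: expansiveness of [g] carries the bound for [f] and [f'] over
    to [Z], and the bound for [g] and [g'] is then read off at the points [f' x]. *)
Lemma close_comp (R : realType) (X : Type) (Y : fuzzy_metric_space R)
    (Z : fms_obj R) (g g' : Y -> Z) (f f' : X -> Y) :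
  uniformly_expansive g -> close g g' -> close f f' ->
  close (g \o f) (g' \o f').
Proof.
move=> gU [r [t [r01 gg']]] /closeP[A [s [A0 ff']]].
apply: (@close_trans _ _ _ _ (g \o f')).
  have [B [u [B0 gB]]] := gU A s A0.
  by apply/closeP; exists B, u; split=> // x; exact: gB.
by exists r, t; split=> // x; exact: gg'.
Qed.

Section Composition.
Context {R : realType}.
Implicit Types X Y Z : fms_obj R.

Definition hom_of X Y (f : X -> Y) (fU : uniformly_expansive f) :
    close_hom X Y :=
  exist _ (close_class f) (mem_set (imageP (@close_class R X Y) fU)).

Lemma hom_class_of X Y (f : X -> Y) (fU : uniformly_expansive f) :
  hom_class (hom_of fU) = close_class f.
Proof. by []. Qed.

Lemma hom_class_inj X Y : injective (@hom_class R X Y).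
Proof. exact: val_inj. Qed.

(** A sigma type, obtained by choice, so that [hom_comp] can extract a representative as data. *)
Lemma hom_repr X Y (F : close_hom X Y) :
  {f : X -> Y | uniformly_expansive f & hom_class F = close_class f}.
Proof.
by have /cid2[f fU fF] := set_mem (valP F); exists f.
Qed.

Definition hom_comp X Y Z (G : close_hom Y Z) (F : close_hom X Y) :
    close_hom X Z :=
  let: exist2 g gU _ := hom_repr G in
  let: exist2 f fU _ := hom_repr F in
  hom_of (uniformly_expansive_comp gU fU).

(** Independence of the representatives: those chosen in [hom_comp] are close to [g] and [f], and
    the chosen [g'] supplies the expansiveness for [close_comp]. *)
Lemma hom_class_comp X Y Z (g : Y -> Z) (f : X -> Y)
    (G : close_hom Y Z) (F : close_hom X Y) :
  hom_class G = close_class g -> hom_class F = close_class f ->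
  hom_class (hom_comp G F) = close_class (g \o f).
Proof.
rewrite /hom_comp; case: (hom_repr G) => g' gU' ->.
case: (hom_repr F) => f' fU' -> /close_classP gg' /close_classP ff'.
exact/close_classP/close_comp.
Qed.

(** Once representatives are fixed, both sides of each law are classes of convertible functions, and
    [hom_class_inj] lifts this to morphisms. *)
Lemma hom_comp_is_category : is_category hom_comp.
Proof.
split=> [W X Y Z H G F|X].
  have [h _ hH] := hom_repr H; have [g _ gG] := hom_repr G.
  have [f _ fF] := hom_repr F.
  apply: hom_class_inj.
  rewrite (hom_class_comp hH (hom_class_comp gG fF)).
  by rewrite (hom_class_comp (hom_class_comp hH gG) fF).
exists (hom_of (@uniformly_expansive_id R X)); split=> [Y F|W F];
  have [f _ fF] := hom_repr F; apply: hom_class_inj; rewrite fF.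
  by rewrite (hom_class_comp fF (hom_class_of _)).
by rewrite (hom_class_comp (hom_class_of _) fF).
Qed.

End Composition.

Theorem theorem5p3 (R : realType) :
  exists comp : forall X Y Z : fms_obj R,
      close_hom Y Z -> close_hom X Y -> close_hom X Z,
    (forall (X Y Z : fms_obj R) (g : Y -> Z) (f : X -> Y)
        (G : close_hom Y Z) (F : close_hom X Y),
        uniformly_expansive g -> uniformly_expansive f ->
        hom_class G = close_class g -> hom_class F = close_class f ->
        hom_class (comp X Y Z G F) = close_class (g \o f)) /\
    is_category comp.
Proof.
exists (@hom_comp R); split; last exact: hom_comp_is_category.
by move=> X Y Z g f G F _ _; exact: hom_class_comp.
Qed.
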